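(* Let $\Sigma$ be a finite functional signature. An algebra $\mathcal{A}$ over $\Sigma$ is almost free if and only if it is free over a finite partial algebra $\mathcal{B}$ over $\Sigma$.
   Context: $\Sigma$ is a finite functional signature having function symbols $f,g,\ldots$ (of positive arity) and constant symbols $c_0,c_1,\ldots$. An algebra over $\Sigma$ is a $\Sigma$-structure in which every function symbol is interpreted by a total operation. A structure is called $\bar c$-generated if it is generated by the values of the constants of $\Sigma$. A partial algebra over $\Sigma$ is a $\Sigma$-structure in which the function symbols are interpreted by operations that may be partial, and which is still required to be generated by the values of the constants of $\Sigma$. Algebras are assumed to be $\bar c$-generated, and homomorphisms preserve the constants. A ground term is a term built only from constants and function symbols of $\Sigma$. $\mathcal{F}$ denotes the algebra of all ground terms, with operations interpreted by term formation. A ground term equation is an expression $p=q$ with $p,q$ ground terms. For a set $\Gamma$ of ground term equations, $\sim_\Gamma$ is the relation on $\mathcal{F}$ given by $p\sim_\Gamma q$ iff $\Gamma\vdash p=q$ (equivalently, the smallest congruence on $\mathcal{F}$ containing all pairs $(p,q)$ with $p=q$ in $\Gamma$), and $\mathcal{F}_\Gamma=\mathcal{F}/{\sim_\Gamma}$. An algebra $\mathcal{A}$ is almost free if there is a finite set $\Gamma$ of ground term equations such that $\mathcal{A}\cong\mathcal{F}_\Gamma$. An algebra $\mathcal{A}$ contains a partial algebra $\mathcal{B}$ as a substructure if there is a homomorphic embedding of $\mathcal{B}$ into $\mathcal{A}$ (an injective map fixing the constants and preserving all values of the operations that are defined in $\mathcal{B}$). An algebra $\mathcal{A}$ is free over $\mathcal{B}$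 if (1) $\mathcal{B}$ is a substructure of $\mathcal{A}$, and (2) every algebra $\mathcal{C}$ that contains $\mathcal{B}$ as a substructure is a homomorphic image of $\mathcal{A}$. *)

(* Defs.v *)
From HB Require Import structures.
From mathcomp Require Import all_boot.
From mathcomp Require Import boolp classical_sets functions cardinality.
From mathcomp Require Import generic_quotient.

Set Implicit Arguments.
Unset Strict Implicit.
Unset Printing Implicit Defensive.

Local Open Scope classical_set_scope.
Local Open Scope quotient_scope.

Record signature := Signature {
  funsym : finType;
  cstsym : finType;
  arity : funsym -> nat;
  arity_gt0 : forall f, 0 < arity f }.

(* The field [alg_gen] says that the only subset containing the constants and
   closed under the operations is the whole carrier. *)
Record algebra (S : signature) := Algebra {
  alg_sort :> Type;
  alg_cst : cstsym S -> alg_sort;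
  alg_op : forall f : funsym S, ('I_(arity f) -> alg_sort) -> alg_sort;
  alg_gen : forall P : set alg_sort,
    (forall c, P (alg_cst c)) ->
    (forall f x, (forall i, P (x i)) -> P (alg_op (f := f) x)) ->
    forall a, P a }.

(* [None] stands for an undefined value; generation only uses the defined
   values of the operations. *)
Record palgebra (S : signature) := PAlgebra {
  palg_sort :> Type;
  palg_cst : cstsym S -> palg_sort;
  palg_op : forall f : funsym S, ('I_(arity f) -> palg_sort) -> option palg_sort;
  palg_gen : forall P : set palg_sort,
    (forall c, P (palg_cst c)) ->
    (forall f x b, (forall i, P (x i)) -> palg_op (f := f) x = Some b -> P b) ->
    forall b, P b }.

Arguments alg_cst {S} _ _.
Arguments alg_op {S} _ _ _.
Arguments palg_cst {S} _ _.
Arguments palg_op {S} _ _ _.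

Section Morphisms.
Variable S : signature.

Definition is_hom (A C : algebra S) (h : A -> C) : Prop :=
  (forall c, h (alg_cst A c) = alg_cst C c) /\
  (forall f x, h (alg_op A f x) = alg_op C f (fun i => h (x i))).

Definition isomorphic (A C : algebra S) : Prop :=
  exists h : A -> C, is_hom h /\ bijective h.

Definition homomorphic_image (A C : algebra S) : Prop :=
  exists h : A -> C, is_hom h /\ (forall y, exists x, h x = y).

(* Operations undefined in [B] are unconstrained: an embedding need not
   reflect definedness. *)
Definition is_embedding (B : palgebra S) (A : algebra S) (h : B -> A) : Prop :=
  [/\ injective h,
      forall c, h (palg_cst B c) = alg_cst A c &
      forall f x b, palg_op B f x = Some b ->
        alg_op A f (fun i => h (x i)) = h b].

Definition contains (A : algebra S) (B : palgebra S) : Prop :=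
  exists h : B -> A, is_embedding h.

Definition free_over (A : algebra S) (B : palgebra S) : Prop :=
  contains A B /\
  (forall C : algebra S, contains C B -> homomorphic_image A C).

End Morphisms.

Section GroundTerms.
Variable S : signature.

Inductive term : Type :=
| Cst of cstsym S
| App (f : funsym S) of ('I_(arity f) -> term).

Lemma term_gen (P : set term) :
  (forall c, P (Cst c)) ->
  (forall f x, (forall i, P (x i)) -> P (@App f x)) ->
  forall t, P t.
Proof. by move=> Pc Pf; elim=> [c|f x IH]; [exact: Pc|exact: Pf]. Qed.

Definition term_algebra : algebra S := Algebra term_gen.

(* A ground term equation [p = q] is the pair [(p, q)]. *)
Inductive derivable (Gamma : set (term * term)) : term -> term -> Prop :=
| d_ax p q : Gamma (p, q) -> derivable Gamma p q
| d_refl p : derivable Gamma p p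
| d_sym p q : derivable Gamma p q -> derivable Gamma q p
| d_trans p q r :
    derivable Gamma p q -> derivable Gamma q r -> derivable Gamma p r
| d_congr f (x y : 'I_(arity f) -> term) :
    (forall i, derivable Gamma (x i) (y i)) ->
    derivable Gamma (App x) (App y).

HB.instance Definition _ := gen_eqMixin term.
HB.instance Definition _ := gen_choiceMixin term.

Variable Gamma : set (term * term).

Definition derivableb : rel term := fun p q => `[< derivable Gamma p q >].

Lemma derivableb_refl : reflexive derivableb.
Proof. by move=> p; apply/asboolP; exact: d_refl. Qed.

Lemma derivableb_sym : symmetric derivableb.
Proof. by move=> p q; apply/asboolP/asboolP; exact: d_sym. Qed.

Lemma derivableb_trans : transitive derivableb.
Proof.
by move=> q p r /asboolP pq /asboolP qr; apply/asboolP; exact: d_trans pq qr.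
Qed.

Canonical derivable_equiv :=
  EquivRel derivableb derivableb_refl derivableb_sym derivableb_trans.

Definition fquot : Type := {eq_quot derivable_equiv}.

Definition fclass (t : term) : fquot := \pi_({eq_quot derivable_equiv}) t.

Definition frepr (a : fquot) : term := repr (a : {eq_quot derivable_equiv}).

(* Representatives are a choice, but the operation does not depend on it:
   see [fquot_opE]. *)
Definition fquot_op (f : funsym S) (x : 'I_(arity f) -> fquot) : fquot :=
  fclass (App (fun i => frepr (x i))).

Lemma freprK a : fclass (frepr a) = a.
Proof. exact: reprK. Qed.

Lemma fclassP p q : fclass p = fclass q <-> derivable Gamma p q.
Proof.
split=> [/eqmodP /asboolP //|pq].
by apply/eqmodP; apply/asboolP.
Qed.

Lemma fquot_opE f (x : 'I_(arity f) -> term) :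
  fquot_op (fun i => fclass (x i)) = fclass (App x).
Proof.
by apply/fclassP; apply: d_congr => i; apply/fclassP; rewrite freprK.
Qed.

Lemma fquot_gen (P : set fquot) :
  (forall c, P (fclass (Cst c))) ->
  (forall f x, (forall i, P (x i)) -> P (fquot_op (f := f) x)) ->
  forall a, P a.
Proof.
move=> Pc Pf a; rewrite -(freprK a); elim: (frepr a) => [c|f x IH].
  exact: Pc.
by rewrite -fquot_opE; exact: Pf.
Qed.

Definition free_quotient : algebra S := Algebra fquot_gen.

End GroundTerms.

Definition almost_free (S : signature) (A : algebra S) : Prop :=
  exists Gamma : set (term S * term S),
    finite_set Gamma /\ isomorphic A (free_quotient Gamma).

(* Main.v *)
(* A generated algebra [A] is determined by its equational diagram, the set of
   pairs of ground terms with the same value in [A]: it is isomorphic to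
   [free_quotient Gamma] iff this diagram is the congruence generated by
   [Gamma], and it maps onto [C] iff its diagram is contained in that of [C].

   If [A] is presented by a finite [Gamma], take for [B] the values in [A] of
   the constants and of the subterms of [Gamma], with [f] defined exactly where
   one of these subterms witnesses it.  In any [C] containing [B] these
   subterms keep their values, so [C] satisfies [Gamma].

   If [A] is free over a finite [B], name every element of [B] by a term and
   let [Gamma] be the operation table of [B].  Since [A] satisfies [Gamma], the
   names stay distinct modulo [Gamma], so [free_quotient Gamma] contains [B],
   and therefore satisfies every equation true in [A]. *)
Require Import Defs.
From mathcomp Require Import all_boot.
From mathcomp Require Import boolp classical_sets functions cardinality.

Set Implicit Arguments.
Unset Strict Implicit.
Unset Printing Implicit Defensive.

Local Open Scope classical_set_scope.

Lemma finite_setT_enum (T : Type) :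
  finite_set [set: T] -> exists n (e : 'I_n -> T), forall y, exists i, e i = y.
Proof.
move=> [n /card_set_bijP[g [g_lt g_inj g_surj]]].
have /choice[e eK] (i : 'I_n) : exists y, g y = i.
  by have [y _ <-] := g_surj _ (ltn_ord i); exists y.
exists n, e => y; have lt_gy : g y < n by exact: g_lt.
by exists (Ordinal lt_gy); apply: g_inj; rewrite ?inE // eK.
Qed.

Section Evaluation.
Variable S : signature.

Fixpoint eval (A : algebra S) (t : term S) : A :=
  match t with
  | Cst c => alg_cst A c
  | App f x => alg_op A f (fun i => eval A (x i))
  end.

Lemma eval_surj (A : algebra S) (a : A) : exists t, eval A t = a.
Proof.
move: a; apply: alg_gen => [c|f x /choice[u uE]]; first by exists (Cst c).
by exists (App u) => /=; congr alg_op; apply/funext.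
Qed.

Lemma hom_eval (A C : algebra S) (h : A -> C) t :
  is_hom h -> h (eval A t) = eval C t.
Proof.
move=> [hc hf]; elim: t => [c|f x IH] /=; first exact: hc.
by rewrite hf; congr alg_op; apply/funext.
Qed.

Lemma eval_sound (A : algebra S) (Gamma : set (term S * term S)) :
  (forall p q, Gamma (p, q) -> eval A p = eval A q) ->
  forall p q, derivable Gamma p q -> eval A p = eval A q.
Proof.
move=> sat p q; elim=> //= {p q} [p q r _ -> _ ->|f x y _ IH] //.
by congr alg_op; apply/funext.
Qed.

Lemma eval_free_quotient Gamma t :
  eval (free_quotient Gamma) t = fclass Gamma t.
Proof.
elim: t => [//|f x IH] /=; rewrite -fquot_opE.
by congr fquot_op; apply/funext.
Qed.

(** The only candidate map sends the value of a term in [A] to its value in [C]; inclusion of the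
    diagrams makes this independent of the term. *)
Lemma homomorphic_imageP (A C : algebra S) :
  homomorphic_image A C <->
  forall p q, eval A p = eval A q -> eval C p = eval C q.
Proof.
split=> [[h [homh _]] p q pq|sub].
  by rewrite -!(hom_eval _ homh) pq.
have /choice[name nameK] := @eval_surj A.
exists (fun a => eval C (name a)); split.
  split=> [c|f x]; first by apply: (sub _ (Cst c)); rewrite nameK.
  apply: (sub _ (App (fun i => name (x i)))); rewrite nameK /=.
  by congr alg_op; apply/funext => i; rewrite nameK.
move=> y; have [t <-] := eval_surj y.
by exists (eval A t); apply: sub; rewrite nameK.
Qed.

(** One inclusion of diagrams yields a surjection through [homomorphic_imageP], the other its
    injectivity. *)
Lemma isomorphic_free_quotientP (A : algebra S) Gamma :
  isomorphic A (free_quotient Gamma) <->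
  forall p q, eval A p = eval A q <-> derivable Gamma p q.
Proof.
split=> [[h [homh /bij_inj injh]] p q|diag].
  rewrite -fclassP -!eval_free_quotient -!(hom_eval _ homh).
  by split=> [->|/injh].
have [|h [homh surjh]] := (homomorphic_imageP A (free_quotient Gamma)).2.
  by move=> p q /diag pq; rewrite !eval_free_quotient; apply/fclassP.
have injh : injective h.
  move=> a b; have [p <-] := eval_surj a; have [q <-] := eval_surj b.
  by rewrite !(hom_eval _ homh) !eval_free_quotient => /fclassP /diag.
exists h; split=> //; have /choice[g gK] := surjh.
by exists g => // a; apply: injh; rewrite gK.
Qed.

Fixpoint subterms (t : term S) : set (term S) :=
  match t with
  | Cst _ => [set t]
  | App f x => [set t] `|` \bigcup_i subterms (x i)
  end.

Lemma subterms_refl t : subterms t t.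
Proof. by case: t => [c|f x] //=; left. Qed.

Lemma subterms_arg t f (x : 'I_(arity f) -> term S) i :
  subterms t (App x) -> subterms t (x i).
Proof.
elim: t => [//|g y IH] [App_eq|[j _ /IH]]; last by right; exists j.
by rewrite -App_eq; right; exists i => //; exact: subterms_refl.
Qed.

Lemma finite_subterms t : finite_set (subterms t).
Proof.
elim: t => [c|f x IH] /=; first exact: finite_set1.
rewrite finite_setU; split; first exact: finite_set1.
by apply: bigcup_finite => //; exact: finite_finset.
Qed.

End Evaluation.

Section TermValues.
Variables (S : signature) (A : algebra S) (T : set (term S)).
Hypothesis T_cst : forall c, T (Cst c).
Hypothesis T_arg : forall f (x : 'I_(arity f) -> term S) i, T (App x) -> T (x i).

Definition tval := {a : A | exists2 t, T t & eval A t = a}.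

Definition tval_of t (Tt : T t) : tval :=
  exist _ (eval A t) (ex_intro2 _ _ t Tt erefl).

Lemma tval_inj (a b : tval) : sval a = sval b -> a = b.
Proof. by apply: eq_sig_hprop => ?; exact: Prop_irrelevance. Qed.

Definition tval_graph f (x : 'I_(arity f) -> tval) (b : tval) :=
  exists u, [/\ T (App u), forall i, eval A (u i) = sval (x i) &
                sval b = eval A (App u)].

Definition tval_op f (x : 'I_(arity f) -> tval) : option tval :=
  if pselect (exists b, tval_graph x b) is left ex_b then Some (sval (cid ex_b))
  else None.

(** The graph is functional: the value of [App u] depends on the values of its arguments, not on the
    witness [u]. *)
Lemma tval_opE f (x : 'I_(arity f) -> tval) b :
  tval_op x = Some b <-> tval_graph x b.
Proof.
have fun_graph b1 b2 : tval_graph x b1 -> tval_graph x b2 -> b1 = b2.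
  move=> [u [_ ux b1E]] [v [_ vx b2E]]; apply: tval_inj; rewrite b1E b2E /=.
  by congr alg_op; apply/funext => i; rewrite ux vx.
rewrite /tval_op; case: pselect => [ex_b|no_b]; last first.
  by split=> // xb; case: no_b; exists b.
case: cid => b' /= xb'; split=> [[<-] //|xb].
by congr Some; exact: fun_graph xb' xb.
Qed.

(** Induction on a term naming the element: [T_arg] keeps it inside [T], and each application in [T]
    witnesses its own defined value. *)
Lemma tval_gen (P : set tval) :
  (forall c, P (tval_of (T_cst c))) ->
  (forall f x b, (forall i, P (x i)) -> tval_op (f := f) x = Some b -> P b) ->
  forall b, P b.
Proof.
move=> Pc Pf [a [t Tt ta]]; case: a / ta; rewrite -/(tval_of Tt).
elim: t Tt => [c|f u IH] Tt; first by rewrite (Prop_irrelevance Tt (T_cst c)).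
apply: (Pf f (fun i => tval_of (T_arg i Tt))) => //.
by apply/tval_opE; exists u.
Qed.

Definition tval_palgebra : palgebra S := PAlgebra tval_gen.

Lemma contains_tval : contains A tval_palgebra.
Proof.
exists (fun b : tval => sval b); split=> // [a b|f x b /tval_opE].
  exact: tval_inj.
by move=> [u [_ ux ->]] /=; congr alg_op; apply/funext => i; rewrite ux.
Qed.

(** Evaluating a term of [T] uses only operations defined in the partial algebra, and [h] preserves
    those. *)
Lemma embedding_tval (C : algebra S) (h : tval_palgebra -> C) t (Tt : T t) :
  is_embedding h -> eval C t = h (tval_of Tt).
Proof.
move=> [_ hc hf]; elim: t Tt => [c|f u IH] Tt.
  by rewrite (Prop_irrelevance Tt (T_cst c)) -/(palg_cst tval_palgebra c) hc.
rewrite -(hf f (fun i => tval_of (T_arg i Tt))).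
  by rewrite /=; congr alg_op; apply/funext => i; exact: IH.
by apply/tval_opE; exists u.
Qed.

Lemma finite_tval : finite_set T -> finite_set [set: tval].
Proof.
move=> finT; pose val (b : tval) : A := sval b.
apply: (@sub_finite_set _ _ (val @^-1` (eval A @` T))).
  by move=> b _; exact: (svalP b).
apply: finite_preimage; last exact: finite_image.
by move=> a b _ _; exact: tval_inj.
Qed.

End TermValues.

Lemma almost_free_free_over (S : signature) (A : algebra S) :
  almost_free A ->
  exists B : palgebra S, finite_set [set: B] /\ free_over A B.
Proof.
move=> [Gamma [finG /isomorphic_free_quotientP diag]].
(* All constants are included, since the partial algebra must interpret even those absent from
   [Gamma]. *)
pose T : set (term S) := range (@Cst S) `|`
  \bigcup_(e in Gamma) (subterms e.1 `|` subterms e.2).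
have T_cst c : T (Cst c) by left; exists c.
have T_arg f (x : 'I_(arity f) -> term S) i : T (App x) -> T (x i).
  move=> [[]//|[e Ge ex]]; right; exists e => //.
  by case: ex => /(subterms_arg i); [left|right].
exists (tval_palgebra A T_cst T_arg); split.
  apply: finite_tval; rewrite finite_setU; split.
    by apply: finite_image; exact: finite_finset.
  apply: bigcup_finite => // e _.
  by rewrite finite_setU; split; exact: finite_subterms.
split=> [|C [h emb]]; first exact: contains_tval.
apply/homomorphic_imageP => p q /diag; apply: eval_sound => {}p {}q Gpq.
have Tp : T p by right; exists (p, q) => //; left; exact: subterms_refl.
have Tq : T q by right; exists (p, q) => //; right; exact: subterms_refl.
(* Agreeing in [A], the two terms name one element of the partial algebra. *)
rewrite (embedding_tval Tp emb) (embedding_tval Tq emb); congr h.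
by apply: tval_inj; apply/diag; exact: d_ax.
Qed.

Lemma free_over_almost_free (S : signature) (A : algebra S) (B : palgebra S) :
  finite_set [set: B] -> free_over A B -> almost_free A.
Proof.
move=> /finite_setT_enum[n [e e_surj]] [[h [injh hc hf]] free].
have /choice[name nameE] : forall b, exists t, eval A t = h b.
  by move=> b; exact: eval_surj.
have /choice[rank rankK] := e_surj.
(* Arguments are indices rather than elements of [B], so that the rows of the table range over a
   finite type. *)
pose args (f : funsym S) (x : 'I_(arity f) -> 'I_n) := App (name \o e \o x).
(* Where the operation of [B] is undefined the equation is trivial, which makes
   the operation table the range of a total function. *)
pose table (j : {f : funsym S & {ffun 'I_(arity f) -> 'I_n}}) :=
  let t := args _ (tagged j) in
  (t, if palg_op B _ (e \o tagged j) is Some b then name b else t).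
(* The name chosen for the value of a constant may be another term, so the two are equated
   explicitly. *)
pose Gamma : set (term S * term S) :=
  range (fun c => (Cst c, name (palg_cst B c))) `|` range table.
have Gamma_op f x b : palg_op B f x = Some b ->
    derivable Gamma (App (name \o x)) (name b).
  move=> xb; apply: d_ax; right.
  exists (Tagged (fun f => {ffun 'I_(arity f) -> 'I_n}) [ffun i => rank (x i)]).
    by [].
  have eE : e \o [ffun i => rank (x i)] = x.
    by apply/funext => i /=; rewrite ffunE rankK.
  by rewrite /table /args /= -compA eE xb.
have sound p q : derivable Gamma p q -> eval A p = eval A q.
  apply: eval_sound => {}p {}q [[c _ [<- <-]]|[j _ [<- <-]]].
    by rewrite nameE hc.
  case xb: palg_op => [b|//]; rewrite nameE -(hf _ _ _ xb) /=.
  by congr alg_op; apply/funext => i; rewrite nameE.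
exists Gamma; split.
  by rewrite finite_setU; split; apply: finite_image; exact: finite_finset.
apply/isomorphic_free_quotientP => p q; split=> [pq|]; last exact: sound.
(* Freeness is tested on the quotient itself, where an equation holds exactly when it is
   derivable. *)
have /free/homomorphic_imageP/(_ p q pq) : contains (free_quotient Gamma) B.
  exists (fun b => fclass Gamma (name b)); split.
  - by move=> a b /fclassP /sound; rewrite !nameE => /injh.
  - by move=> c; apply/fclassP/d_sym/d_ax; left; exists c.
  - by move=> f x b xb; rewrite /= fquot_opE; apply/fclassP; exact: Gamma_op.
by rewrite !eval_free_quotient => /fclassP.
Qed.

Theorem theorem2p7 (S : signature) (A : algebra S) :
  almost_free A <->
  exists B : palgebra S, finite_set [set: B]%classic /\ free_over A B.
Proof.
split=> [|[B [finB free]]]; first exact: almost_free_free_over.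
exact: free_over_almost_free finB free.
Qed.
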